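(* Let $\mathbf f:\mathcal Z\to\mathcal X$ be a $C^2$-diffeomorphism ($\mathcal Z=\mathbb R^{d_z}$, $\mathcal X=\mathbf f(\mathcal Z)\subseteq\mathbb R^{d_x}$). If $\mathbf f$ is additive and sufficiently nonlinear, then $\mathbf f$ has at most first-order interactions across slots, satisfies sufficient independence of order 1, and satisfies interaction asymmetry of order 1 for all equivalent generators.
   Context: Fix a partition $\{B_1,\dots,B_K\}$ of $[d_z]$ into nonempty slots; $\mathbf z_S=(z_i)_{i\in S}$; $D_i\mathbf f(\mathbf z),D^2_{i,i'}\mathbf f(\mathbf z)\in\mathbb R^{d_x}$ are column vectors and $[\cdot]$ is horizontal concatenation. Additive: $\mathbf f(\mathbf z)=\sum_{k=1}^K\mathbf f^k(\mathbf z_{B_k})$ for some $\mathbf f^k:\mathbb R^{|B_k|}\to\mathbb R^{d_x}$ and all $\mathbf z$. Sufficiently nonlinear: with $B^2_{k\le}:=\{(i,i')\in B_k^2:i'\le i\}$, for every $\mathbf z$ the matrix $\mathbf W(\mathbf z):=[[D_i\mathbf f(\mathbf z)]_{i\in B_k}\,[D^2_{i,i'}\mathbf f(\mathbf z)]_{(i,i')\in B^2_{k\le}}]_{k\in[K]}$ has full column rank. At most first-order interaction between $\mathbf z_A,\mathbf z_B$: $D^2_{i,j}\mathbf f(\mathbf z)=\mathbf 0$ for all $\mathbf z$, $i\in A$, $j\in B$; if this fails at some $\mathbf z$, they have second-order interaction at $\mathbf z$. At most first-order interactions across slots: all pairs of distinct slots have at most first-order interaction. Sufficient independence of order 1: for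 all $\mathbf z$, $\mathrm{rank}\big([[D_i\mathbf f(\mathbf z)]_{i\in B_k}\,[D^2_{i,i'}\mathbf f(\mathbf z)]_{(i,i')\in B_k^2}]_{k\in[K]}\big)=\sum_k\big[\mathrm{rank}([D_i\mathbf f(\mathbf z)]_{i\in B_k})+\mathrm{rank}([D^2_{i,i'}\mathbf f(\mathbf z)]_{(i,i')\in B_k^2})\big]$. Interaction asymmetry of order 1: (i) at most first-order interactions across slots on $\mathbb R^{d_z}$; (ii) for every $\mathbf z$, every $k$, and all nonempty $A,B$ with $A\cup B=B_k$, $\mathbf z_A,\mathbf z_B$ have second-order interaction at $\mathbf z$. Equivalent generator: $\bar{\mathbf f}$ with $\bar{\mathbf f}(\mathbf M_1\mathbf z_{B_1},\dots,\mathbf M_K\mathbf z_{B_K})=\mathbf f(\mathbf z)$ for all $\mathbf z$ and some invertible $\mathbf M_k\in\mathbb R^{|B_k|\times|B_k|}$; ''for all equivalent generators'' means every such $\bar{\mathbf f}$ satisfies interaction asymmetry of order 1. *)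

(* Defs.v *)
From HB Require Import structures.
From mathcomp Require Import all_boot all_order all_algebra.
From mathcomp Require Import all_classical all_reals all_analysis.
Set Implicit Arguments. Unset Strict Implicit. Unset Printing Implicit Defensive.
Import Order.TTheory GRing.Theory Num.Theory.
Import numFieldNormedType.Exports.
Local Open Scope classical_set_scope.
Local Open Scope ring_scope.

Section Defs.
Variable R : realType.

Definition evec (n : nat) (i : 'I_n) : 'rV[R]_n := delta_mx 0 i.

Definition D1 (dz dx : nat) (i : 'I_dz) (f : 'rV[R]_dz -> 'rV[R]_dx)
  (z : 'rV[R]_dz) : 'rV[R]_dx := 'D_(evec i) f z.

Definition D2 (dz dx : nat) (i i' : 'I_dz) (f : 'rV[R]_dz -> 'rV[R]_dx)
  (z : 'rV[R]_dz) : 'rV[R]_dx := 'D_(evec i) (D1 i' f) z.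

Definition C2 (dz dx : nat) (f : 'rV[R]_dz -> 'rV[R]_dx) : Prop :=
  continuous f /\
  (forall z i, derivable f z (evec i)) /\
  (forall z i i', derivable (D1 i' f) z (evec i)) /\
  (forall i, continuous (D1 i f)) /\
  (forall i i', continuous (D2 i i' f)).

Definition colmx (dx : nat) (s : seq 'rV[R]_dx) : 'M[R]_(dx, size s) :=
  \matrix_(r < dx, c < size s) (nth 0 s c) 0 r.

Definition full_col_rank (dx : nat) (s : seq 'rV[R]_dx) : Prop :=
  \rank (colmx s) = size s.

Definition jacobian_cols (dz dx : nat) (f : 'rV[R]_dz -> 'rV[R]_dx) z :=
  [seq D1 i f z | i <- Finite.enum 'I_dz].

(* C^2-diffeomorphism of R^dz onto its image X = f(R^dz) in R^dx, i.e. a C^2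
   embedding: C^2, immersive (injective differential), injective, with an
   inverse X -> R^dz that is continuous on X. *)
Definition gen_C2_diffeo (dz dx : nat) (f : 'rV[R]_dz -> 'rV[R]_dx) : Prop :=
  C2 f /\
  (forall z, full_col_rank (jacobian_cols f z)) /\
  injective f /\
  (exists g : 'rV[R]_dx -> 'rV[R]_dz,
      (forall z, g (f z) = z) /\ {within range f, continuous g}).

(* The slot partition {B_1..B_K} of [d_z] into nonempty slots is given by a
   surjective map slot : 'I_dz -> 'I_K, with B_k = [set i | slot i == k]. *)
Definition gen_is_partition (dz K : nat) (slot : 'I_dz -> 'I_K) : Prop :=
  forall k : 'I_K, exists i : 'I_dz, slot i = k.

Definition blk (dz K : nat) (slot : 'I_dz -> 'I_K) (k : 'I_K) : {set 'I_dz} :=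
  [set i | slot i == k].

Definition depends_only_on (dz dx : nat) (S : {set 'I_dz})
  (g : 'rV[R]_dz -> 'rV[R]_dx) : Prop :=
  forall z z' : 'rV[R]_dz, (forall i, i \in S -> z 0 i = z' 0 i) -> g z = g z'.

(* Additive: f(z) = sum_k f^k(z_{B_k}); each f^k is represented as a function
   of z depending only on the coordinates z_{B_k}. *)
Definition gen_additive (dz dx K : nat) (slot : 'I_dz -> 'I_K)
  (f : 'rV[R]_dz -> 'rV[R]_dx) : Prop :=
  exists fk : 'I_K -> 'rV[R]_dz -> 'rV[R]_dx,
    (forall k, depends_only_on (blk slot k) (fk k)) /\
    (forall z, f z = \sum_(k < K) fk k z).

Definition firstcols (dz dx K : nat) (slot : 'I_dz -> 'I_K)
  (f : 'rV[R]_dz -> 'rV[R]_dx) z (k : 'I_K) :=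
  [seq D1 i f z | i <- [seq i <- Finite.enum 'I_dz | slot i == k]].

Definition secondcols_le (dz dx K : nat) (slot : 'I_dz -> 'I_K)
  (f : 'rV[R]_dz -> 'rV[R]_dx) z (k : 'I_K) :=
  [seq D2 p.1 p.2 f z | p <- [seq p <- Finite.enum ('I_dz * 'I_dz)%type
     | [&& slot p.1 == k, slot p.2 == k & (p.2 <= p.1)%N]]].

Definition secondcols (dz dx K : nat) (slot : 'I_dz -> 'I_K)
  (f : 'rV[R]_dz -> 'rV[R]_dx) z (k : 'I_K) :=
  [seq D2 p.1 p.2 f z | p <- [seq p <- Finite.enum ('I_dz * 'I_dz)%type
     | (slot p.1 == k) && (slot p.2 == k)]].

Definition Wcols (dz dx K : nat) (slot : 'I_dz -> 'I_K)
  (f : 'rV[R]_dz -> 'rV[R]_dx) z :=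
  flatten [seq firstcols slot f z k ++ secondcols_le slot f z k
          | k <- Finite.enum 'I_K].

Definition gen_sufficiently_nonlinear (dz dx K : nat) (slot : 'I_dz -> 'I_K)
  (f : 'rV[R]_dz -> 'rV[R]_dx) : Prop :=
  forall z, full_col_rank (Wcols slot f z).

Definition at_most_first_order (dz dx : nat) (f : 'rV[R]_dz -> 'rV[R]_dx)
  (A B : {set 'I_dz}) : Prop :=
  forall z i j, i \in A -> j \in B -> D2 i j f z = 0.

Definition second_order_at (dz dx : nat) (f : 'rV[R]_dz -> 'rV[R]_dx)
  (A B : {set 'I_dz}) (z : 'rV[R]_dz) : Prop :=
  exists i j, [/\ i \in A, j \in B & D2 i j f z != 0].

Definition gen_first_order_across_slots (dz dx K : nat) (slot : 'I_dz -> 'I_K)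
  (f : 'rV[R]_dz -> 'rV[R]_dx) : Prop :=
  forall k k' : 'I_K, k != k' -> at_most_first_order f (blk slot k) (blk slot k').

Definition gen_sufficient_independence1 (dz dx K : nat) (slot : 'I_dz -> 'I_K)
  (f : 'rV[R]_dz -> 'rV[R]_dx) : Prop :=
  forall z,
    \rank (colmx (flatten [seq firstcols slot f z k ++ secondcols slot f z k
                          | k <- Finite.enum 'I_K]))
    = (\sum_(k < K) (\rank (colmx (firstcols slot f z k))
                     + \rank (colmx (secondcols slot f z k))))%N.

Definition gen_interaction_asymmetry1 (dz dx K : nat) (slot : 'I_dz -> 'I_K)
  (f : 'rV[R]_dz -> 'rV[R]_dx) : Prop :=
  gen_first_order_across_slots slot f /\
  (forall (z : 'rV[R]_dz) (k : 'I_K) (A B : {set 'I_dz}),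
      A != finset.set0 -> B != finset.set0 -> A :|: B = blk slot k ->
      second_order_at f A B z).

(* Block-diagonal invertible linear maps z |-> (M_1 z_{B_1}, ..., M_K z_{B_K}):
   represented by an invertible dz x dz matrix M with M i j = 0 whenever
   i and j lie in different slots; it acts on z (a row vector) as z *m M^T,
   i.e. as M z in column convention. *)
Definition block_invertible (dz K : nat) (slot : 'I_dz -> 'I_K)
  (M : 'M[R]_dz) : Prop :=
  M \in unitmx /\ (forall i j, slot i != slot j -> M i j = 0).

Definition gen_equivalent_generator (dz dx K : nat) (slot : 'I_dz -> 'I_K)
  (f fbar : 'rV[R]_dz -> 'rV[R]_dx) : Prop :=
  exists M : 'M[R]_dz, block_invertible slot M /\
    forall z, fbar (z *m M^T) = f z.

End Defs.

(* Main.v *)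
(* Additivity makes each first derivative depend on the coordinates of its own
   slot only, so mixed second derivatives across slots vanish.  Symmetry of
   second derivatives shows that the columns indexed by all pairs of a slot
   span the same space as those with i' <= i, whence the rank formula.

   An equivalent generator is z |-> f(N z) with N block diagonal invertible,
   hence again additive.  Its second derivative in directions i, j of slot k is
   the combination of the D2_(a,b) f(N z) with weights N_ai N_bj.  If it were
   zero, linear independence would make the product of the linear forms given
   by columns i and j of N vanish as a polynomial, although both columns are
   nonzero. *)
Require Import Defs.
From HB Require Import structures.
From mathcomp Require Import all_boot all_order all_algebra.
From mathcomp Require Import all_classical all_reals all_analysis.
From mathcomp Require Import ring.
Set Implicit Arguments. Unset Strict Implicit. Unset Printing Implicit Defensive.
Import Order.TTheory GRing.Theory Num.Theory.
Import numFieldNormedType.Exports.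
Local Open Scope classical_set_scope.
Local Open Scope ring_scope.

(** * Difference quotients and limits along a punctured neighbourhood of 0 *)

Lemma derive_eq_increment (R : realType) (U V W : normedModType R)
    (f : U -> W) (g : V -> W) x v y w :
  (forall h : R, f (h *: v + x) - f x = g (h *: w + y) - g y) ->
  'D_v f x = 'D_w g y.
Proof.
move=> fg; rewrite /derive.
suff -> : (fun h : R => h^-1 *: ((f \o shift x) (h *: v) - f x)) =
          (fun h => h^-1 *: ((g \o shift y) (h *: w) - g y)) by [].
by apply/funext => h /=; rewrite fg.
Qed.

(** Mean value parameters, picked by choice for each [h], are known only through such a bound; it
    still sends them to 0 with [h]. *)
Lemma dominated_cvg0 (R : realType) (sg : R -> R) (c : R) :
  (forall h, `|sg h| <= `|h * c|) -> sg h @[h --> 0^'] --> (0 : R).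
Proof.
move=> sgP; apply/norm_cvg0P.
apply: (@squeeze_cvgr _ _ _ _ (fun=> 0) (fun h => `|h * c|)).
- by near=> h; rewrite normr_ge0 sgP.
- exact: cvg_cst.
- have : `|h * c| @[h --> (0 : R)^'] --> `|0 * c|.
    by apply: cvg_norm; apply: cvgMr_tmp; exact: nbhs_dnbhs.
  by rewrite mul0r normr0.
Unshelve. all: by end_near. Qed.

Lemma cvg_perturbation (R : realType) (V : normedModType R) (s1 s2 : R -> R)
    (z v w : V) :
  s1 h @[h --> 0^'] --> (0 : R) -> s2 h @[h --> 0^'] --> (0 : R) ->
  (z + s1 h *: v + s2 h *: w) @[h --> 0^'] --> z.
Proof.
move=> s10 s20.
have : (z + s1 h *: v + s2 h *: w) @[h --> 0^'] --> z + 0 *: v + 0 *: w.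
  apply: cvgD; last exact: cvgZr_tmp.
  by apply: cvgD; [exact: cvg_cst|exact: cvgZr_tmp].
by rewrite !scale0r !addr0.
Qed.

(** * Directional derivatives: mean values along lines, linearity in the direction, symmetry *)

Section DirectionalDerivatives.
Variables (R : realType) (V : normedModType R).
Implicit Types (z v w : V) (s t c : R).

Lemma difference_quotient_shift (W : normedModType R) (f : V -> W) z v s :
  (fun h => h^-1 *: (((fun r => f (z + r *: v)) \o shift s) (h *: (1 : R))
                     - f (z + s *: v)))
  = (fun h => h^-1 *: ((f \o shift (z + s *: v)) (h *: v) - f (z + s *: v))).
Proof.
apply/funext => h /=; congr (_ *: (f _ - _)).
by rewrite [h *: 1]mulr1 scalerDl addrCA addrA addrC addrA.
Qed.

Lemma is_derive_line (f : V -> R) z v s :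
  derivable f (z + s *: v) v ->
  is_derive s (1 : R) (fun r => f (z + r *: v)) ('D_v f (z + s *: v)).
Proof.
move=> df; apply: DeriveDef.
  by rewrite /derivable difference_quotient_shift.
by rewrite /derive difference_quotient_shift.
Qed.

Lemma mean_value_line (f : V -> R) z v t :
  (forall s, derivable f (z + s *: v) v) ->
  exists2 s, `|s| <= `|t| &
    f (z + t *: v) - f z = t * 'D_v f (z + s *: v).
Proof.
move=> df.
have dphi s : is_derive s (1 : R) (fun r => f (z + r *: v)) ('D_v f (z + s *: v)).
  exact: is_derive_line.
have cphi a b : {within `[a, b]%classic, continuous (fun r => f (z + r *: v))}.
  apply: derivable_within_continuous => s _.
  by have [] := dphi s.
have [t0|t0] := leP 0 t.
  have [s + E] := MVT_segment t0 (fun s _ => dphi s) (@cphi 0 t).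
  rewrite in_itv /= => /andP[s0 st].
  exists s; first by rewrite !ger0_norm.
  by move: E; rewrite scale0r addr0 subr0 mulrC.
have [s + E] := MVT_segment (ltW t0) (fun s _ => dphi s) (@cphi t 0).
rewrite in_itv /= => /andP[ts s0].
exists s; first by rewrite !ler0_norm ?(ltW t0)// lerN2.
move: E; rewrite scale0r addr0 sub0r => E.
by rewrite -opprB E mulrC mulNr opprK.
Qed.

(** The step along [h *: (w + c *: v)] is taken as [h *: w] followed by [(h * c) *: v]. The quotient
    of the first leg tends to [l]; the mean value theorem turns that of the second into [c] times
    ['D_v f] at a point tending to [z], where ['D_v f] is continuous. *)
Lemma is_derive_directionD (f : V -> R) z w v c l :
  is_derive z w f l -> (forall x, derivable f x v) ->
  {for z, continuous ('D_v f)} ->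
  is_derive z (w + c *: v) f (l + c * 'D_v f z).
Proof.
move=> [dw dwE] dv cv.
have /choice[sg sgP] h : exists s, `|s| <= `|h * c| /\
    f (z + h *: w + (h * c) *: v) - f (z + h *: w)
      = (h * c) * 'D_v f (z + h *: w + s *: v).
  by have [s] := @mean_value_line f (z + h *: w) v (h * c) (fun=> dv _); exists s.
have pz : (z + h *: w + sg h *: v) @[h --> 0^'] --> z.
  apply: cvg_perturbation; first exact: nbhs_dnbhs.
  by apply: (@dominated_cvg0 _ _ c) => h; case: (sgP h).
have Dp : 'D_v f (z + h *: w + sg h *: v) @[h --> 0^'] --> 'D_v f z.
  exact: (cvg_comp _ _ pz cv).
have lim : h^-1 *: ((f \o shift z) (h *: (w + c *: v)) - f z) @[h --> 0^']
    --> l + c * 'D_v f z.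
  have : h^-1 *: ((f \o shift z) (h *: w) - f z)
          + c * 'D_v f (z + h *: w + sg h *: v) @[h --> 0^']
      --> l + c * 'D_v f z.
    apply: cvgD; first by rewrite -dwE.
    exact: cvgMl_tmp.
  apply: cvg_trans; apply: near_eq_cvg; near=> h.
  have hn0 : h != 0 by near: h; exact: nbhs_dnbhs_neq.
  rewrite /= (addrC _ z) (addrC _ z) (scalerDr h) (scalerA h c) addrA.
  rewrite -[X in _ = h^-1 *: X](subrKA (f (z + h *: w))) (sgP h).2.
  by rewrite [RHS]mulrDr -mulrA mulKf // [RHS]addrC.
apply: DeriveDef; first by apply/cvg_ex; eexists; exact: lim.
exact: (cvg_lim _ lim).
Unshelve. all: by end_near. Qed.

Lemma second_derivatives_commute (g : V -> R) z v w :
  (forall x, derivable g x v) -> (forall x, derivable g x w) ->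
  (forall x, derivable ('D_v g) x w) -> (forall x, derivable ('D_w g) x v) ->
  {for z, continuous ('D_w ('D_v g))} -> {for z, continuous ('D_v ('D_w g))} ->
  'D_w ('D_v g) z = 'D_v ('D_w g) z.
Proof.
(* The double increment of g along t v and t w is symmetric in v and w, and two
   mean value steps turn it into t ^+ 2 times either mixed derivative at a
   point tending to z with t. *)
have double_increment (a b : V) t : (forall x, derivable g x a) ->
    (forall x, derivable ('D_a g) x b) ->
    exists s : R * R, [/\ `|s.1| <= `|t|, `|s.2| <= `|t| &
     g (z + t *: a + t *: b) - g (z + t *: a) - (g (z + t *: b) - g z) =
     t * (t * 'D_b ('D_a g) (z + s.1 *: a + s.2 *: b))].
  move=> da dba.
  pose k x := g (x + t *: b) - g x.
  have kq x : is_derive x a k ('D_a g (x + t *: b) - 'D_a g x).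
    apply: is_deriveB; last exact/derivableP.
    have E : (fun h : R => h^-1 *: (((fun x => g (x + t *: b)) \o shift x)
                                      (h *: a) - g (x + t *: b)))
       = (fun h => h^-1 *: ((g \o shift (x + t *: b)) (h *: a)
                              - g (x + t *: b))).
      by apply/funext => h /=; rewrite addrA.
    by apply: DeriveDef; rewrite /derivable /derive E //; exact: da.
  have [|s1 s1t E1] := @mean_value_line k z a t.
    by move=> s; case: (kq (z + s *: a)).
  have [|s2 s2t E2] := @mean_value_line ('D_a g) (z + s1 *: a) b t.
    by move=> s; exact: dba.
  exists (s1, s2); split => //=.
  rewrite -E2.
  have [_ <-] := kq (z + s1 *: a).
  by rewrite -E1.
move=> dv dw dwv dvw cwv cvw.
have /choice[p pP] t := double_increment v w t dv dwv.
have /choice[q qP] t := double_increment w v t dw dvw.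
have limz (s : R -> R * R) a b : (forall t, `|(s t).1| <= `|t|) ->
    (forall t, `|(s t).2| <= `|t|) ->
    (z + (s h).1 *: a + (s h).2 *: b) @[h --> 0^'] --> z.
  by move=> s1 s2; apply: cvg_perturbation; apply: (@dominated_cvg0 _ _ 1) => h;
    rewrite mulr1.
have Lp : 'D_w ('D_v g) (z + (p h).1 *: v + (p h).2 *: w) @[h --> 0^']
    --> 'D_w ('D_v g) z.
  by apply: (cvg_comp _ _ (limz p v w _ _) cwv) => t; case: (pP t).
have Lq : 'D_v ('D_w g) (z + (q h).1 *: w + (q h).2 *: v) @[h --> 0^']
    --> 'D_v ('D_w g) z.
  by apply: (cvg_comp _ _ (limz q w v _ _) cvw) => t; case: (qP t).
apply: (cvg_unique _ Lp); first exact: norm_hausdorff.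
apply: cvg_trans Lq; apply: near_eq_cvg; near=> h.
have hn0 : h != 0 by near: h; exact: nbhs_dnbhs_neq.
have [_ _ Ep] := pP h; have [_ _ Eq] := qP h.
apply: (mulfI hn0); apply: (mulfI hn0); rewrite -Ep -Eq.
by rewrite (addrAC z (h *: w)); ring.
Unshelve. all: by end_near. Qed.

End DirectionalDerivatives.

(** * Continuous partial derivatives: directional derivatives, symmetry, linear substitution *)

Section PartialDerivatives.
Variables (R : realType) (n m : nat).

(** The direction is built up one basis vector at a time, each handled by [is_derive_directionD]. *)
Lemma is_derive_partials_scalar (g : 'rV[R]_n -> R) z (v : 'rV[R]_n) :
  (forall x i, derivable g x (evec R i)) ->
  (forall i, {for z, continuous ('D_(evec R i) g)}) ->
  is_derive z v g (\sum_i v 0 i * 'D_(evec R i) g z).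
Proof.
move=> dg cg; rewrite [v in is_derive _ v]row_sum_delta.
elim: (index_enum _) => [|i s IH].
  rewrite !big_nil.
  have E : (fun h : R => h^-1 *: ((g \o shift z) (h *: (0 : 'rV[R]_n)) - g z))
      = cst 0.
    by apply/funext => h /=; rewrite scaler0 add0r subrr scaler0.
  apply: DeriveDef; rewrite ?/derivable ?/derive E; first exact: is_cvg_cst.
  exact: lim_cst.
rewrite !big_cons addrC [X in is_derive _ _ _ X]addrC.
rewrite -[delta_mx _ i]/(evec R i).
by apply: is_derive_directionD => [x|]; [exact: dg|exact: cg].
Qed.

Section VectorValued.
Variable f : 'rV[R]_n -> 'rV[R]_m.
Hypothesis df : forall x i, derivable f x (evec R i).

Lemma derive_coord i a b :
  'D_(evec R i) (fun x => f x a b) = (fun x => D1 i f x a b).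
Proof. by apply/funext => x; rewrite /D1 derive_mx// mxE. Qed.

Lemma is_derive_partials z (v : 'rV[R]_n) :
  (forall i, continuous (D1 i f)) ->
  is_derive z v f (\sum_i v 0 i *: D1 i f z).
Proof.
move=> cf.
have fab a b : is_derive z v (fun x => f x a b) (\sum_i v 0 i * D1 i f z a b).
  under eq_bigr do rewrite -[D1 _ _ _ _ _]/((fun x => D1 _ f x a b) z) -derive_coord.
  apply: is_derive_partials_scalar => [x i|i]; first exact: (derivable_mxP _ _ _).1.
  rewrite derive_coord.
  apply: (@continuous_comp _ _ _ (D1 i f) (fun y => y a b)); first exact: cf.
  exact: coord_continuous.
have dfv : derivable f z v by apply/derivable_mxP => a b; case: (fab a b).
apply: DeriveDef => //; apply/matrixP => a b.
rewrite derive_mx// mxE (@derive_val _ _ _ _ _ _ _ (fab a b)) summxE.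
by apply: eq_bigr => i _; rewrite mxE.
Qed.

End VectorValued.

Lemma D2_sym (f : 'rV[R]_n -> 'rV[R]_m) i j z :
  C2 f -> D2 i j f z = D2 j i f z.
Proof.
move=> [_ [df [ddf [_ cf]]]]; apply/matrixP => a b.
(* Symmetry is a scalar statement, so it is checked on each coordinate of [f]. *)
have E k l x : D2 k l f x a b = 'D_(evec R k) ('D_(evec R l) (fun x => f x a b)) x.
  rewrite (derive_coord df); apply: esym.
  exact: (congr1 (@^~ x) (derive_coord (fun x i => ddf x i l) k a b)).
have C k l : continuous ('D_(evec R k) ('D_(evec R l) (fun x => f x a b))).
  rewrite (_ : 'D_(evec R k) _ = fun x => D2 k l f x a b) => [x|]; last first.
    by apply/funext => x; rewrite E.
  apply: (@continuous_comp _ _ _ (D2 k l f) (fun y => y a b)); first exact: cf.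
  exact: coord_continuous.
apply: (etrans (E i j z)); apply: (etrans _ (esym (E j i z))).
apply: second_derivatives_commute => [x|x|x|x||].
- exact: (derivable_mxP _ _ _).1.
- exact: (derivable_mxP _ _ _).1.
- by rewrite (derive_coord df); exact: (derivable_mxP _ _ _).1.
- by rewrite (derive_coord df); exact: (derivable_mxP _ _ _).1.
- exact: C.
- exact: C.
Qed.

Lemma derive_linear_comp (g : 'rV[R]_n -> 'rV[R]_m) (N : 'M[R]_n) (v z : 'rV[R]_n) :
  'D_v (fun x => g (x *m N)) z = 'D_(v *m N) g (z *m N).
Proof.
by apply: derive_eq_increment => h; rewrite mulmxDl -scalemxAl.
Qed.

Lemma D2_linear_comp (f : 'rV[R]_n -> 'rV[R]_m) (N : 'M[R]_n) i j z : C2 f ->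
  D2 i j (fun x => f (x *m N^T)) z =
  \sum_a \sum_b (N a i * N b j) *: D2 a b f (z *m N^T).
Proof.
move=> [_ [df [ddf [cf cdf]]]].
have col k b : (evec R k *m N^T) 0 b = N b k.
  by rewrite /evec -rowE !mxE.
(* [evec R j *m N^T] is column [j] of [N], so [G] is the derivative of [f] in that direction;
   differentiating it along column [i] gives the double sum. *)
pose G := \sum_b (N b j \*: D1 b f).
have D1E : D1 j (fun x => f (x *m N^T)) = (fun x => G (x *m N^T)).
  apply/funext => x; rewrite /D1 derive_linear_comp.
  have [_ ->] := is_derive_partials df (x *m N^T) (evec R j *m N^T) cf.
  by rewrite /G fct_sumE; apply: eq_bigr => b _; rewrite col.
rewrite /D2 D1E derive_linear_comp exchange_big /=.
have db b : is_derive (z *m N^T) (evec R i *m N^T) (N b j \*: D1 b f)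
    (\sum_a (N a i * N b j) *: D2 a b f (z *m N^T)).
  have [d E] := is_derive_partials (fun x a => ddf x a b) (z *m N^T)
    (evec R i *m N^T) (fun a => cdf a b).
  apply: is_derive_eq; first exact/is_deriveZ/derivableP.
  rewrite E scaler_sumr; apply: eq_bigr => a _.
  by rewrite col scalerA mulrC.
by have [] := is_derive_sum db.
Qed.

End PartialDerivatives.

(** * Ranks of column matrices and free families *)

Section FreeColumns.
Import VectorInternalTheory.
Variables (R : realType) (dx : nat).
Implicit Types (s : seq 'rV[R]_dx).

Lemma rank_colmx s : \rank (colmx s) = (\dim << s >>)%VS.
Proof.
pose A : 'M[R]_(size s, dx) := (colmx s)^T.
have -> : \dim << s >>%VS = \rank (b2mx (in_tuple s)).
  by rewrite unlock /dimv /= mxrank_gen.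
(* The rows of [b2mx] are the images of the vectors under the coordinate isomorphism [v2r], whose
   injectivity preserves the rank. *)
have -> : b2mx (in_tuple s) = A *m lin1_mx v2r.
  apply/row_matrixP => i; rewrite row_mul mul_rV_lin1 rowK; congr v2r.
  by apply/rowP => j; rewrite !mxE (tnth_nth 0).
rewrite mxrankMfree ?mxrank_tr//; apply: inj_row_free => v.
by rewrite mul_rV_lin1 => v0; apply: v2r_inj; rewrite v0 linear0.
Qed.

Lemma full_col_rankE s : full_col_rank s <-> free s.
Proof. by rewrite /full_col_rank rank_colmx /free; split => [->|/eqP]. Qed.

Lemma free_flatten (ss : seq (seq 'rV[R]_dx)) s :
  free (flatten ss) -> s \in ss -> free s.
Proof.
elim: ss => //= t ss IH fs; rewrite inE => /predU1P[->|sss].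
  exact: catl_free fs.
by apply: IH sss; exact: catr_free fs.
Qed.

End FreeColumns.

Lemma free_map_sum_eq0 (K : fieldType) (vT : vectType K) (I : eqType)
    (r : seq I) (F : I -> vT) (c : I -> K) :
  free [seq F p | p <- r] -> \sum_(p <- r) c p *: F p = 0 ->
  {in r, forall p, c p = 0}.
Proof.
elim: r => //= q r IH; rewrite free_cons big_cons => /andP[qr fr] s0.
have cq : c q = 0.
  apply: contraNeq qr => cq0.
  have -> : F q = - (c q)^-1 *: \sum_(p <- r) c p *: F p.
    by rewrite -(addr0_eq s0) scalerN scaleNr opprK scalerA mulVf// scale1r.
  rewrite memvZ// big_seq; apply: memv_suml => p pr.
  by rewrite memvZ// memv_span// map_f.
move=> p; rewrite inE => /predU1P[->//|pr].
by apply: IH pr => //; move: s0; rewrite cq scale0r add0r.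
Qed.

Lemma sum_sym_lower_triangle (K : fieldType) (vT : vectType K) n
    (D : 'I_n -> 'I_n -> vT) (u w : 'I_n -> K) :
  (forall a b, D a b = D b a) ->
  \sum_a \sum_b (u a * w b) *: D a b =
  \sum_(p : 'I_n * 'I_n | (p.2 <= p.1)%N)
    (u p.1 * w p.2 + (if (p.2 < p.1)%N then u p.2 * w p.1 else 0)) *: D p.1 p.2.
Proof.
move=> sym; rewrite pair_big/= (bigID (fun p : 'I_n * 'I_n => (p.2 <= p.1)%N))/=.
under [RHS]eq_bigr do rewrite scalerDl.
rewrite big_split/=; congr (_ + _).
(* What remains are the pairs above the diagonal; swapping their entries moves them strictly below
   it, and [sym] keeps the vector. *)
have swapK : involutive (fun p : 'I_n * 'I_n => (p.2, p.1)) by case.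
rewrite (reindex_inj (inv_inj swapK))/=.
rewrite big_mkcond [RHS]big_mkcond; apply: eq_bigr => -[i j] _ /=.
by rewrite -ltnNge sym; case: ltngtP => //= _; rewrite scale0r.
Qed.

(* The polynomial (u . X)(w . X) is nonzero when u and w are, so one of the
   coefficients of its expansion in the monomials X_a X_b, b <= a, survives. *)
Lemma free_sym_product_neq0 (K : fieldType) (vT : vectType K) n (Q : pred 'I_n)
    (D : 'I_n -> 'I_n -> vT) (u w : 'I_n -> K) x y :
  (forall a b, D a b = D b a) ->
  free [seq D p.1 p.2 | p <- [seq p <- Finite.enum ('I_n * 'I_n)%type
    | [&& Q p.1, Q p.2 & (p.2 <= p.1)%N]]] ->
  (forall a, ~~ Q a -> u a = 0) -> (forall a, ~~ Q a -> w a = 0) ->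
  u x != 0 -> w y != 0 ->
  \sum_a \sum_b (u a * w b) *: D a b != 0.
Proof.
move=> sym fr u0 w0 ux wy.
have xQ : Q x by apply: contraNT ux => /u0 ->.
have yQ : Q y by apply: contraNT wy => /w0 ->.
rewrite sum_sym_lower_triangle//.
pose c (p : 'I_n * 'I_n) :=
  u p.1 * w p.2 + (if (p.2 < p.1)%N then u p.2 * w p.1 else 0).
rewrite (eq_bigr (fun p => c p *: D p.1 p.2))//.
apply/negP => /eqP.
(* A pair with an index outside [Q] has coefficient zero, since [u] and [w] both vanish there. *)
rewrite (bigID (fun p : 'I_n * 'I_n => Q p.1 && Q p.2))/= addrC big1 ?add0r; last first.
  move=> p /andP[_]; rewrite negb_and /c => /orP[h|h];
  by rewrite (u0 _ h) (w0 _ h) !(mul0r, mulr0) if_same addr0 scale0r.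
rewrite (eq_bigl (fun p : 'I_n * 'I_n => [&& Q p.1, Q p.2 & (p.2 <= p.1)%N]));
  last by move=> p; rewrite andbC andbA.
rewrite -big_filter [index_enum _]unlock => /(free_map_sum_eq0 fr) c0.
have {}c0 a b : Q a -> Q b -> (b <= a)%N -> c (a, b) = 0.
  by move=> aQ bQ ba; apply: c0; rewrite mem_filter -enumT mem_enum /= aQ bQ ba.
(* The diagonal coefficients [u x * w x] and [u y * w y] vanish, so [w x = 0] and [u y = 0]. The
   coefficient of the pair formed by [x] and [y] then reduces to [u x * w y], which is nonzero;
   [x = y] already contradicts [w x = 0]. *)
have wx : w x = 0.
  have /eqP := c0 x x xQ xQ (leqnn _).
  by rewrite /c/= ltnn addr0 mulf_eq0 (negPf ux) => /eqP.
have uy : u y = 0.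
  have /eqP := c0 y y yQ yQ (leqnn _).
  by rewrite /c/= ltnn addr0 mulf_eq0 (negPf wy) orbF => /eqP.
have /eqP xy : u x * w y != 0 by rewrite mulf_neq0.
apply: xy; case: (ltngtP x y) => [lt|gt|/val_inj E].
- by have := c0 y x yQ xQ (ltnW lt); rewrite /c/= lt uy mul0r add0r.
- by have := c0 x y xQ yQ (ltnW gt); rewrite /c/= gt uy mul0r addr0.
- by rewrite -E wx mulr0.
Qed.

(** * Additivity, independence and block-diagonal maps relative to the slots *)

Section Slots.
Variables (R : realType) (dz dx K : nat) (slot : 'I_dz -> 'I_K).
Implicit Types f : 'rV[R]_dz -> 'rV[R]_dx.

Lemma additive_first_order_across_slots f :
  gen_additive slot f -> gen_first_order_across_slots slot f.
Proof.
move=> [fk [fkP fE]] k k' kk' z i j; rewrite !inE => /eqP ik /eqP jk'.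
(* Moving coordinate [j] changes only the summand of its slot [k']; all others cancel in the
   increment. *)
have diffE (x : 'rV[R]_dz) (h : R) : f (h *: evec R j + x) - f x
    = fk k' (h *: evec R j + x) - fk k' x.
  rewrite !fE -sumrB (bigD1 k')//= big1 ?addr0// => l lk'.
  apply/eqP; rewrite subr_eq0; apply/eqP/fkP => a; rewrite inE => /eqP al.
  rewrite !mxE (_ : (a == j) = false) ?andbF ?mulr0 ?add0r//.
  by apply: contraNF lk' => /eqP aj; rewrite -al aj jk'.
have D1E (x y : 'rV[R]_dz) : (forall a, a \in blk slot k' -> x 0 a = y 0 a) ->
    D1 j f x = D1 j f y.
  move=> xy; apply: derive_eq_increment => h.
  rewrite !diffE; congr (_ - _); apply: fkP => a ak'; last exact: xy.
  by rewrite !mxE xy.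
(* A step along [evec R i] leaves slot [k'] untouched, so the difference quotient of [D1 j f] is
   identically zero. *)
rewrite /D2 /derive (_ : (fun h => _) = cst 0) ?lim_cst//.
apply/funext => h /=; rewrite (D1E _ z) ?subrr ?scaler0// => a.
rewrite inE => /eqP ak'; rewrite !mxE (_ : (a == i) = false) ?andbF ?mulr0 ?add0r//.
by apply: contraNF kk' => /eqP ai; rewrite -ik -ai ak'.
Qed.

Lemma secondcols_mem f z k : (forall i j, D2 i j f z = D2 j i f z) ->
  secondcols slot f z k =i secondcols_le slot f z k.
Proof.
move=> sym x; apply/mapP/mapP => -[[i j]]; rewrite mem_filter -!enumT mem_enum andbT.
  move=> /andP[/= ik jk] ->.
  have [ji|ij] := leqP j i.
    by exists (i, j); rewrite // mem_filter mem_enum /= ik jk ji.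
  by exists (j, i); rewrite // mem_filter mem_enum /= ik jk (ltnW ij).
move=> /= /and3P[ik jk _] ->.
by exists (i, j); rewrite // mem_filter mem_enum /= ik jk.
Qed.

(** Dropping the repeated columns leaves all spans unchanged, and then every family involved is a
    subfamily of the free family [Wcols]. Each rank is thus a number of columns, and these numbers
    add up. *)
Lemma sufficient_independence_of_nonlinear f :
  C2 f -> gen_sufficiently_nonlinear slot f ->
  gen_sufficient_independence1 slot f.
Proof.
move=> C2f nl z.
have sym i j : D2 i j f z = D2 j i f z by exact: D2_sym.
have secE k := secondcols_mem k sym.
have /full_col_rankE freeW := nl z.
have freek k : free (firstcols slot f z k ++ secondcols_le slot f z k).
  apply: free_flatten freeW _.
  by apply/mapP; exists k; rewrite // -enumT mem_enum.
rewrite rank_colmx.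
have /eq_span-> : flatten [seq firstcols slot f z k ++ secondcols slot f z k
    | k <- Finite.enum 'I_K] =i Wcols slot f z.
  move=> x; apply/flatten_mapP/flatten_mapP => -[k ke]; exists k => //.
    by rewrite mem_cat -secE -mem_cat.
  by rewrite mem_cat secE -mem_cat.
move: (freeW); rewrite /free => /eqP ->.
rewrite size_flatten /shape -map_comp sumnE big_map -enumT big_enum.
apply: eq_bigr => k _ /=.
rewrite size_cat !rank_colmx (eq_span (secE k)).
have := catl_free (freek k); have := catr_free (freek k).
by rewrite /free => /eqP -> /eqP ->.
Qed.

Lemma block_invmx (M : 'M[R]_dz) :
  block_invertible slot M -> block_invertible slot (invmx M).
Proof.
move=> [Mu Mb]; split; first by rewrite unitmx_inv.
move=> i j ij.
(* [P] projects onto the coordinates of the slot of [j]. A block-diagonal matrix commutes with it,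
   hence so does the inverse, and entry [(i, j)] of that identity is the claim. *)
pose P : 'M[R]_dz := diag_mx (\row_a (slot a == slot j)%:R).
have PM : P *m M = M *m P.
  apply/matrixP => a b; rewrite mul_diag_mx mul_mx_diag !mxE mulrC.
  by have [->//|/Mb->] := eqVneq (slot a) (slot b); rewrite !mul0r.
have : P *m invmx M = invmx M *m P.
  by rewrite -[LHS](mulKmx Mu) [M *m _]mulmxA -PM -mulmxA mulmxV// mulmx1.
move=> /matrixP/(_ i j); rewrite mul_diag_mx mul_mx_diag !mxE eqxx mulr1.
by rewrite (negPf ij) mul0r.
Qed.

Lemma additive_block_comp f (N : 'M[R]_dz) :
  (forall i j, slot i != slot j -> N i j = 0) ->
  gen_additive slot f -> gen_additive slot (fun z => f (z *m N^T)).
Proof.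
move=> Nb [fk [fkP fE]]; exists (fun k z => fk k (z *m N^T)); split=> [k z z' zz'|z].
  apply: fkP => a; rewrite inE => /eqP ak; rewrite !mxE; apply: eq_bigr => b _.
  rewrite !mxE; have [bk|bk] := eqVneq (slot b) k.
    by rewrite zz' ?inE ?bk.
  by rewrite Nb ?mulr0// ak eq_sym.
exact: fE.
Qed.

Lemma unitmx_col_neq0 (N : 'M[R]_dz) i : N \in unitmx -> exists a, N a i != 0.
Proof.
move=> Nu; apply/existsP; apply: contraLR Nu => /existsPn N0.
apply/negP => Nu; have := mulVmx Nu => /matrixP/(_ i i)/eqP.
rewrite !mxE eqxx big1 => [|a _]; first by rewrite eq_sym oner_eq0.
by have /negPn/eqP -> := N0 a; rewrite mulr0.
Qed.

End Slots.

Theorem mainTheorem10 (R : realType) (dz dx K : nat) (slot : 'I_dz -> 'I_K)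
  (f : 'rV[R]_dz -> 'rV[R]_dx) :
  gen_is_partition slot ->
  gen_C2_diffeo f ->
  gen_additive slot f ->
  gen_sufficiently_nonlinear slot f ->
  [/\ gen_first_order_across_slots slot f,
      gen_sufficient_independence1 slot f &
      forall fbar : 'rV[R]_dz -> 'rV[R]_dx,
        gen_equivalent_generator slot f fbar -> gen_interaction_asymmetry1 slot fbar].
Proof.
move=> _ [C2f _] addf nl; split.
- exact: additive_first_order_across_slots.
- exact: sufficient_independence_of_nonlinear.
move=> fbar [M [Mb fbarE]]; have [Nu Nb] := block_invmx Mb.
set N := invmx M in Nu Nb.
have -> : fbar = (fun z => f (z *m N^T)).
  apply/funext => z; rewrite -fbarE -mulmxA -trmx_mul.
  by rewrite mulmxV ?trmx1 ?mulmx1//; case: Mb.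
split; first exact/additive_first_order_across_slots/additive_block_comp.
(* Any [i] in [A] and [j] in [B] serve as witnesses, the case [i = j] included; only their
   membership in slot [k] matters. *)
move=> z k A B /set0Pn[i iA] /set0Pn[j jB] AB; exists i, j; split => //.
have ik : slot i = k.
  by have : i \in blk slot k by [rewrite -AB inE iA]; rewrite inE => /eqP.
have jk : slot j = k.
  by have : j \in blk slot k by [rewrite -AB inE jB orbT]; rewrite inE => /eqP.
rewrite D2_linear_comp//.
(* [x] and [y] mark nonzero entries of columns [i] and [j] of [N], both supported in slot [k]. *)
have [x ux] := unitmx_col_neq0 i Nu; have [y wy] := unitmx_col_neq0 j Nu.
have fr : free (secondcols_le slot f (z *m N^T) k).
  have /full_col_rankE freeW := nl (z *m N^T).
  apply: catr_free (free_flatten freeW _).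
  by apply/mapP; exists k; rewrite // -enumT mem_enum.
have sym a b : D2 a b f (z *m N^T) = D2 b a f (z *m N^T) by exact: D2_sym.
have Ni a : slot a != k -> N a i = 0 by rewrite -ik; exact: Nb.
have Nj a : slot a != k -> N a j = 0 by rewrite -jk; exact: Nb.
exact: (@free_sym_product_neq0 R 'rV[R]_dx dz (fun a => slot a == k)
  (fun a b => D2 a b f (z *m N^T)) (N^~ i) (N^~ j) x y sym fr Ni Nj ux wy).
Qed.
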